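(* Let $H$ and $K$ be real Hilbert spaces, let $A$ be a norm-closed real subalgebra (resp. norm-closed real Jordan subalgebra) of $B(H)$, and assume that $I_H \notin A$. Let $\pi : A \to B(K)$ be a contractive homomorphism (resp. contractive Jordan homomorphism). Let $A^1 = \mathrm{span}_{\mathbb{R}}\{A, I_H\} \subseteq B(H)$ and define $\pi^o : A^1 \to B(K)$ by $\pi^o(a + \lambda I_H) = \pi(a) + \lambda I_K$ for $a \in A$, $\lambda \in \mathbb{R}$. Then $\pi^o$ is a contractive homomorphism (resp. contractive Jordan homomorphism).
   Context: All maps are $\mathbb{R}$-linear. $B(H)$ is the real algebra of bounded operators on the real Hilbert space $H$ with the operator norm. A real subspace $A\subseteq B(H)$ is a (real) Jordan subalgebra if $a^2 \in A$ for all $a\in A$ (equivalently, $\frac12(ab+ba)\in A$ for all $a,b\in A$). Subalgebras are not assumed selfadjoint. A Jordan homomorphism is a linear map $\pi$ with $\pi(ab+ba)=\pi(a)\pi(b)+\pi(b)\pi(a)$, equivalently $\pi(a^2)=\pi(a)^2$. Contractive means $\|\pi(a)\| \le \|a\|$ for all $a$; only the norm (no matrix norms) is involved. *)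

(* Defs.v *)
From HB Require Import structures.
From mathcomp Require Import all_boot all_order all_algebra.
From mathcomp Require Import all_classical all_reals topology normedtype.

Set Implicit Arguments.
Unset Strict Implicit.
Unset Printing Implicit Defensive.

Import Order.TTheory GRing.Theory Num.Theory.
Import numFieldNormedType.Exports.

Local Open Scope classical_set_scope.
Local Open Scope ring_scope.

HB.mixin Record NormedModule_hasInner (R : realType) H of NormedModule R H := {
  inner : H -> H -> R ;
  innerC : forall x y, inner x y = inner y x ;
  innerDl : forall x y z, inner (x + y) z = inner x z + inner y z ;
  innerZl : forall (a : R) x y, inner (a *: x) y = a * inner x y ;
  inner_sqr_norm : forall x, inner x x = `|x| ^+ 2
}.

#[short(type="hilbertType")]
HB.structure Definition Hilbert (R : realType) :=
  {H of CompleteNormedModule R H & NormedModule_hasInner R H}.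

Section bounded_operators.
Variables (R : realType) (V : normedModType R).

Definition bounded_linear : {pred V -> V} :=
  mem [set f : V -> V | linear f /\
    exists M : R, forall x, `|f x| <= M * `|x| ].

Record boundedOp := BoundedOp {
  boundedOp_fun :> V -> V ;
  _ : boundedOp_fun \in bounded_linear
}.

HB.instance Definition _ := [isSub for boundedOp_fun].
HB.instance Definition _ := [Choice of boundedOp by <:].

Lemma bounded_linearP (f : V -> V) : f \in bounded_linear <->
  linear f /\ exists M : R, forall x, `|f x| <= M * `|x|.
Proof. by split => [/set_mem//|fP]; exact/mem_set. Qed.

Lemma bounded_linear_submod : submod_closed bounded_linear.
Proof.
split=> [|a f g /bounded_linearP[lf [M fM]] /bounded_linearP[lg [N gN]]].
  apply/bounded_linearP; split=> [a x y|]; first by rewrite /= scaler0 addr0.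
  by exists 0 => x; rewrite mul0r normr0.
apply/bounded_linearP; split=> [b x y|].
  change (a *: f (b *: x + y) + g (b *: x + y) =
    b *: (a *: f x + g x) + (a *: f y + g y)).
  rewrite lf lg !scalerDr !scalerA (mulrC a b) -!addrA; congr (_ + _).
  by rewrite addrCA.
exists (`|a| * M + N) => x; rewrite mulrDl.
apply: (le_trans (ler_normD _ _)); rewrite lerD// normrZ -mulrA.
exact: ler_wpM2l.
Qed.

HB.instance Definition _ :=
  GRing.isSubmodClosed.Build R (V -> V) bounded_linear bounded_linear_submod.
HB.instance Definition _ := [SubChoice_isSubLmodule of boundedOp by <:].

Implicit Types S T : boundedOp.

Lemma boundedOp_linear T : linear T.
Proof. by case: T => f /= /bounded_linearP[]. Qed.

Lemma boundedOp_bounded T : exists M : R, forall x, `|T x| <= M * `|x|.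
Proof. by case: T => f /= /bounded_linearP[]. Qed.

Lemma boundedOp_eqP S T : S =1 T -> S = T.
Proof. by move=> ST; apply/val_inj/funext. Qed.

Lemma boundedOpD S T x : (S + T) x = S x + T x.
Proof. by []. Qed.

Lemma boundedOpZ (a : R) T x : (a *: T) x = a *: T x.
Proof. by []. Qed.

Lemma boundedOp0 x : (0 : boundedOp) x = 0.
Proof. by []. Qed.

Lemma bounded_linear_id : idfun \in bounded_linear.
Proof. by apply/bounded_linearP; split=> //; exists 1 => x; rewrite mul1r. Qed.

Lemma bounded_linear_comp S T : S \o T \in bounded_linear.
Proof.
apply/bounded_linearP; split=> [a x y|]; first by rewrite /= !boundedOp_linear.
have [M SM] := boundedOp_bounded S; have [N TN] := boundedOp_bounded T.
exists (`|M| * N) => x /=; apply: (le_trans (SM _)).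
apply: (le_trans (ler_wpM2r (normr_ge0 _) (ler_norm M))).
by rewrite -mulrA ler_wpM2l.
Qed.

Definition idOp := BoundedOp bounded_linear_id.
Definition compOp S T := BoundedOp (bounded_linear_comp S T).

Fact compOpA : associative compOp.
Proof. by move=> S T U; exact: boundedOp_eqP. Qed.
Fact compOp1l : left_id idOp compOp.
Proof. by move=> T; exact: boundedOp_eqP. Qed.
Fact compOp1r : right_id idOp compOp.
Proof. by move=> T; exact: boundedOp_eqP. Qed.
Fact compOpDl : left_distributive compOp +%R.
Proof. by move=> S T U; exact: boundedOp_eqP. Qed.
Fact compOpDr : right_distributive compOp +%R.
Proof.
move=> S T U; apply: boundedOp_eqP => x.
by have := boundedOp_linear S 1 (T x) (U x); rewrite !scale1r.
Qed.

(* pzRingType, because V may be the zero space, in which case 1 = 0 *)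
HB.instance Definition _ := GRing.Zmodule_isPzRing.Build boundedOp
  compOpA compOp1l compOp1r compOpDl compOpDr.

Lemma boundedOp1 : 1 = idOp.
Proof. by []. Qed.

Lemma boundedOpM S T x : (S * T) x = S (T x).
Proof. by []. Qed.

Definition opnorm T : R := sup [set `|T x| | x in [set x | `|x| <= 1]].

Lemma opnorm_has_sup T : has_sup [set `|T x| | x in [set x | `|x| <= 1]].
Proof.
split; first by exists `|T 0|, 0 => //=; rewrite normr0.
have [M TM] := boundedOp_bounded T.
exists `|M| => _ [x /= x1 <-]; apply: (le_trans (TM x)).
apply: (le_trans (ler_wpM2r (normr_ge0 _) (ler_norm M))).
by rewrite ler_piMr.
Qed.

Lemma opnorm_ge0 T : 0 <= opnorm T.
Proof.
apply: (le_trans (normr_ge0 (T 0))); apply: sup_ubound.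
  exact: (opnorm_has_sup T).2.
by exists 0 => //=; rewrite normr0.
Qed.

Lemma boundedOp_norm_le T x : `|T x| <= opnorm T * `|x|.
Proof.
have TZ a y : T (a *: y) = a *: T y.
  have T0 : T 0 = 0.
    by have /eqP := boundedOp_linear T 1 0 0; rewrite !scale1r addr0
      -subr_eq subrr => /eqP.
  by have := boundedOp_linear T a y 0; rewrite !addr0 T0 addr0.
have [->|x0] := eqVneq x 0.
  by have := TZ 0 0; rewrite !scale0r => ->; rewrite !normr0 mulr0.
have nx0 : 0 < `|x| by rewrite normr_gt0.
rewrite -ler_pdivrMr// mulrC.
apply: sup_ubound; first exact: (opnorm_has_sup T).2.
exists (`|x|^-1 *: x) => /=; last by rewrite TZ normrZ normfV normr_id.
by rewrite normrZ normfV normr_id mulVf// gt_eqF.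
Qed.

Lemma opnorm_le T (M : R) :
  0 <= M -> (forall x, `|T x| <= M * `|x|) -> opnorm T <= M.
Proof.
move=> M0 TM; apply: ge_sup; first exact: (opnorm_has_sup T).1.
by move=> _ [x /= x1 <-]; rewrite (le_trans (TM x))// ler_piMr.
Qed.

Fact opnormD S T : opnorm (S + T) <= opnorm S + opnorm T.
Proof.
apply: opnorm_le => [|x]; first by rewrite addr_ge0 ?opnorm_ge0.
by rewrite mulrDl (le_trans (ler_normD _ _))// lerD ?boundedOp_norm_le.
Qed.

Fact opnormZ (a : R) T : opnorm (a *: T) = `|a| * opnorm T.
Proof.
have le b U : opnorm (b *: U) <= `|b| * opnorm U.
  apply: opnorm_le => [|x]; first by rewrite mulr_ge0 ?opnorm_ge0.
  by rewrite boundedOpZ normrZ -mulrA ler_wpM2l ?boundedOp_norm_le.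
apply/eqP; rewrite eq_le le/=.
have [->|a0] := eqVneq a 0; first by rewrite normr0 mul0r opnorm_ge0.
have := le a^-1 (a *: T).
by rewrite scalerA mulVf// scale1r normfV -ler_pdivrMl ?invr_gt0 ?normr_gt0// invrK.
Qed.

Fact opnorm0_eq0 T : opnorm T = 0 -> T = 0.
Proof.
move=> T0; apply: boundedOp_eqP => x; apply/normr0_eq0/eqP.
by rewrite eq_le normr_ge0 andbT (le_trans (boundedOp_norm_le T x))// T0 mul0r.
Qed.

HB.instance Definition _ :=
  Lmodule_isNormed.Build R boundedOp opnormD opnormZ opnorm0_eq0.

Lemma boundedOp_normE T : `|T| = sup [set `|T x| | x in [set x | `|x| <= 1]].
Proof. by []. Qed.

End bounded_operators.

Arguments idOp {R} V.

Notation "''B' ( V )" := (@boundedOp _ V)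
  (at level 8, format "''B' ( V )") : type_scope.

Section jordan.
Variables (R : realType) (V W : normedModType R).
Implicit Types (A : set 'B(V)) (pi : 'B(V) -> 'B(W)).

Definition subspace A :=
  A 0 /\ forall (c : R) a b, A a -> A b -> A (c *: a + b).

Definition subalgebra A :=
  subspace A /\ forall a b, A a -> A b -> A (a * b).

Definition jordan_subalgebra A := subspace A /\ forall a, A a -> A (a ^+ 2).

Definition linear_span A : set 'B(V) := smallest subspace A.

(* A map defined on A is represented by a total function on 'B(V); its values
   outside A are irrelevant to the predicates below. *)
Definition linear_on A pi := forall (c : R) a b, A a -> A b ->
  pi (c *: a + b) = c *: pi a + pi b.

Definition contractive_on A pi := forall a, A a -> `|pi a| <= `|a|.

Definition homomorphism_on A pi :=
  linear_on A pi /\ forall a b, A a -> A b -> pi (a * b) = pi a * pi b.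

Definition jordan_homomorphism_on A pi :=
  linear_on A pi /\ forall a b, A a -> A b ->
    pi (a * b + b * a) = pi a * pi b + pi b * pi a.

Definition unitization A : set 'B(V) := linear_span (A `|` [set idOp V]).

(* When A is a subspace not containing idOp V, the decomposition
   x = a + c *: idOp V chosen here is unique; the value outside the unitization
   of A is irrelevant. *)
Definition unital_extension A pi (x : 'B(V)) : 'B(W) :=
  let p := xget ((0, 0) : 'B(V) * R)
    [set p : 'B(V) * R | A p.1 /\ x = p.1 + p.2 *: idOp V] in
  pi p.1 + p.2 *: idOp W.

End jordan.

(* Main.v *)
(* Normalise [T = a + c I] so that [`|T| < 1] and [`|c| < 1].  The Moebius
   transform [S = (T - c)(1 - c T)^-1 = a (1 - c T)^-1] is a contraction, is a
   power series in [a] without constant term, and so lies in [A]; hence [pi S]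
   is a contraction, and undoing the transform in [B(K)] shows that
   [pi a + c I] is one.  Both steps are the identity
   [`|u - c x| ^ 2 - `|x - c u| ^ 2 = (1 - c ^ 2) (`|u| ^ 2 - `|x| ^ 2)].
   The bound [`|c| <= `|T|] holds because otherwise
   [1 - (T / c) ^ n], which is in [A], would converge to [I]. *)
Require Import Defs.
From HB Require Import structures.
From mathcomp Require Import all_boot all_order all_algebra.
From mathcomp Require Import all_classical all_reals topology normedtype.
From mathcomp Require Import sequences ring.

Import Order.TTheory GRing.Theory Num.Theory.
Import numFieldNormedType.Exports.

Local Open Scope classical_set_scope.
Local Open Scope ring_scope.

(** * Products, powers and affine expressions of bounded operators *)

Section operators.
Context {R : realType} {V : normedModType R}.
Implicit Types (S T : 'B(V)) (c d : R).

Lemma boundedOp_scale T c x : T (c *: x) = c *: T x.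
Proof.
have T0 : T 0 = 0.
  have /eqP := boundedOp_linear T 1 0 0.
  by rewrite !scale1r addr0 -subr_eq subrr => /eqP.
by have := boundedOp_linear T c x 0; rewrite !addr0 T0 addr0.
Qed.

Lemma boundedOp_scalel c S T : c *: S * T = c *: (S * T).
Proof. exact: boundedOp_eqP. Qed.

Lemma boundedOp_scaler c S T : S * (c *: T) = c *: (S * T).
Proof. by apply: boundedOp_eqP => x; exact: boundedOp_scale. Qed.

Lemma boundedOp_le_norm T x : `|T x| <= `|T| * `|x|.
Proof. exact: boundedOp_norm_le. Qed.

Lemma boundedOp_normM S T : `|S * T| <= `|S| * `|T|.
Proof.
apply: opnorm_le => [|x]; first by rewrite mulr_ge0.
apply: le_trans (boundedOp_le_norm S (T x)) _.
by rewrite -mulrA ler_wpM2l// boundedOp_le_norm.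
Qed.

Lemma boundedOp_normX T n : `|T ^+ n| <= `|T| ^+ n.
Proof.
elim: n => [|n ih]; last first.
  by rewrite !exprS (le_trans (boundedOp_normM _ _))// ler_wpM2l.
by rewrite !expr0; apply: opnorm_le => // x; rewrite mul1r.
Qed.

(** Turns powers into Jordan products, which Jordan subalgebras and Jordan homomorphisms respect. *)
Lemma boundedOp_exprSS T n :
  T ^+ n.+2 = 2^-1 *: (T * T ^+ n.+1 + T ^+ n.+1 * T).
Proof.
rewrite -exprS -exprSr -mulr2n -[_ ^+ _ *+ _]scaler_nat scalerA.
by rewrite mulVf ?pnatr_eq0 ?scale1r.
Qed.

(** Drives inductions on [n] with [k] general: each step removes an affine factor and leaves a
    positive power of [T] in front, so no constant term ever appears. *)
Lemma boundedOp_mul_affineXS T c d k n :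
  T ^+ k.+1 * (c *: T + d *: idOp V) ^+ n.+1 =
  c *: (T ^+ k.+2 * (c *: T + d *: idOp V) ^+ n) +
  d *: (T ^+ k.+1 * (c *: T + d *: idOp V) ^+ n).
Proof.
rewrite [_ ^+ n.+1]exprS mulrA mulrDr !boundedOp_scaler mulr1 -exprSr mulrDl.
by rewrite !boundedOp_scalel.
Qed.

Lemma boundedOp_mul_affine S T c d :
  (S + c *: idOp V) * (T + d *: idOp V) =
  S * T + (d *: S + c *: T) + (c * d) *: idOp V.
Proof.
by rewrite mulrDl !mulrDr !boundedOp_scalel !boundedOp_scaler !mulr1 !mul1r
  scalerA !addrA.
Qed.

End operators.

(** * Subspaces, the unitization and the unital extension *)

Section subspaces.
Context {R : realType} {V : normedModType R} {A : set 'B(V)}.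
(* [Defs.subspace] is qualified: topology's [subspace] shadows it. *)
Hypothesis sA : Defs.subspace A.

Lemma subspace_add a b : A a -> A b -> A (a + b).
Proof. by move=> Aa Ab; rewrite -[a]scale1r; exact: sA.2. Qed.

Lemma subspace_scale (c : R) a : A a -> A (c *: a).
Proof. by move=> Aa; have := sA.2 c a 0 Aa sA.1; rewrite addr0. Qed.

Lemma subspace_opp a : A a -> A (- a).
Proof. by rewrite -scaleN1r; exact: subspace_scale. Qed.

Lemma subspace_sum n (F : nat -> 'B(V)) :
  (forall i, A (F i)) -> A (\sum_(i < n) F i).
Proof.
move=> AF; elim: n => [|n ih]; first by rewrite big_ord0; exact: sA.1.
by rewrite big_ord_recr; exact: subspace_add.
Qed.

Lemma unitizationE :
  unitization A = [set x | exists a (c : R), A a /\ x = a + c *: idOp V].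
Proof.
rewrite eqEsubset; split=> [x|x [a [c [Aa ->]]] M [[M0 sM] AIM]].
  apply; split; last first.
    move=> a [Aa|->]; first by exists a, 0; rewrite scale0r addr0.
    by exists 0, 1; rewrite scale1r add0r; split=> //; exact: sA.1.
  split; first by exists 0, 0; rewrite scale0r addr0; split=> //; exact: sA.1.
  move=> c _ _ [a [d [Aa ->]]] [b [e [Ab ->]]].
  exists (c *: a + b), (c * d + e); split; first exact: sA.2.
  by rewrite scalerDr scalerDl scalerA addrACA.
by rewrite addrC; apply: sM; apply: AIM; [right | left].
Qed.

Lemma unitization_subspace : Defs.subspace (unitization A).
Proof.
split=> [M [[]]//|c a b Ua Ub M sM].
by apply: sM.1.2; [exact: Ua | exact: Ub].
Qed.

Section linear_maps.
Context {W : normedModType R} { pi : 'B(V) -> 'B(W)}.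
Hypothesis lpi : linear_on A pi.

Lemma linear_on0 : pi 0 = 0.
Proof.
have /eqP := lpi 1 0 0 sA.1 sA.1.
by rewrite !scale1r addr0 -subr_eq subrr => /eqP.
Qed.

Lemma linear_on_add a b : A a -> A b -> pi (a + b) = pi a + pi b.
Proof. by move=> Aa Ab; have := lpi 1 a b Aa Ab; rewrite !scale1r. Qed.

Lemma linear_on_scale (c : R) a : A a -> pi (c *: a) = c *: pi a.
Proof. by move=> Aa; have := lpi c a 0 Aa sA.1; rewrite linear_on0 !addr0. Qed.

Lemma linear_on_sum n (F : nat -> 'B(V)) : (forall i, A (F i)) ->
  pi (\sum_(i < n) F i) = \sum_(i < n) pi (F i).
Proof.
move=> AF; elim: n => [|n ih]; first by rewrite !big_ord0 linear_on0.
by rewrite !big_ord_recr/= linear_on_add ?ih//; exact: subspace_sum.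
Qed.

Hypothesis AI : ~ A (idOp V).

Lemma unital_extensionE a (c : R) : A a ->
  unital_extension A pi (a + c *: idOp V) = pi a + c *: idOp W.
Proof.
move=> Aa; rewrite /unital_extension.
rewrite (@xget_subset1 _ _ _ (a, c))//= => -[a1 c1] [a2 c2].
move=> /= [Aa1 e1] [Aa2 e2]; have e : (c2 - c1) *: idOp V = a1 - a2.
  rewrite scalerBl; apply/eqP; rewrite subr_eq addrAC eq_sym subr_eq.
  by rewrite -e1 e2 addrC.
have [c12|c12] := eqVneq c1 c2.
  move: e; rewrite c12 subrr scale0r => /esym/eqP.
  by rewrite subr_eq0 => /eqP ->.
have c21 : c2 - c1 != 0 by rewrite subr_eq0 eq_sym.
(* Two different scalars would make the identity a multiple of [a1 - a2], which lies in [A]. *)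
exfalso; apply: AI; rewrite -[idOp V]scale1r -(mulVf c21) -scalerA e.
by apply: subspace_scale; apply: subspace_add => //; exact: subspace_opp.
Qed.

Lemma unital_extension_linear :
  linear_on (unitization A) (unital_extension A pi).
Proof.
rewrite unitizationE => c _ _ [a [d [Aa ->]]] [b [e [Ab ->]]].
have -> : c *: (a + d *: idOp V) + (b + e *: idOp V) =
    (c *: a + b) + (c * d + e) *: idOp V.
  by rewrite scalerDr scalerDl scalerA addrACA.
rewrite !unital_extensionE ?lpi//; last exact: sA.2.
by rewrite scalerDr scalerDl scalerA addrACA.
Qed.

End linear_maps.
End subspaces.

(** * The Moebius inequality in a Hilbert space *)

Section hilbert.
Context {R : realType} {H : hilbertType R}.
Implicit Types (u x : H) (c : R).

Lemma norm_subZ_sqr u x c :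
  `|u - c *: x| ^+ 2 = `|u| ^+ 2 - 2 * c * inner u x + c ^+ 2 * `|x| ^+ 2.
Proof.
have DN y z : `|y - c *: z| ^+ 2 = inner (y - c *: z) (y - c *: z).
  by rewrite inner_sqr_norm.
rewrite DN -scaleNr innerDl innerZl ![inner _ (_ + _)]innerC !innerDl !innerZl.
by rewrite -!inner_sqr_norm [inner x u]innerC; ring.
Qed.

(** An equivalence, because it serves both ways: from a contraction [T] to its transform, and from
    the estimate for the transform back to [pi a + c I]. *)
Lemma norm_moebius u x c : `|c| < 1 ->
  (`|u - c *: x| <= `|x - c *: u|) = (`|u| <= `|x|).
Proof.
move=> c1; have c2 : 0 < 1 - c ^+ 2.
  by rewrite subr_gt0 -real_normK ?num_real// expr_lt1.
rewrite -ler_sqr ?nnegrE// -[RHS]ler_sqr ?nnegrE// !norm_subZ_sqr.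
rewrite [inner x u]innerC -subr_ge0.
rewrite -[RHS]subr_ge0 -[RHS](pmulr_rge0 _ c2); congr (_ <= _); ring.
Qed.

End hilbert.

(** Discards the error made by truncating a geometric series. *)
Lemma le_of_geometric_error (R : realType) (q x y z : R) :
  `|q| < 1 -> (forall n, x <= y + q ^+ n * z) -> x <= y.
Proof.
move=> q1 xyz; have : y + q ^+ n * z @[n --> \oo] --> y + 0 * z.
  by apply: cvgD; [exact: cvg_cst | apply: cvgMl; exact: cvg_expr].
rewrite mul0r addr0 => /cvgr_to_ge; apply.
exact: nearW.
Qed.

Section jordan.
Context {R : realType}.

(** * Jordan subalgebras: powers, and the bound on the scalar part *)

Section algebra.
Context {V : normedModType R} {A : set 'B(V)}.
Hypothesis jA : jordan_subalgebra A.

(** Polarization of the square. *)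
Lemma jordan_subalgebra_mulC a b : A a -> A b -> A (a * b + b * a).
Proof.
move=> Aa Ab; have -> : a * b + b * a = (a + b) ^+ 2 - a ^+ 2 - b ^+ 2.
  rewrite !expr2 mulrDl !mulrDr !addrA.
  by rewrite [_ - a * a]addrAC addrK -[a * a + _ + _]addrA [RHS]addrC addKr.
have [sA sq] := jA.
do 2 (apply: (subspace_add sA); last by apply: (subspace_opp sA); exact: sq).
by apply: sq; exact: subspace_add.
Qed.

Lemma jordan_subalgebra_X a n : A a -> A (a ^+ n.+1).
Proof.
move=> Aa; elim: n => // n ih.
rewrite boundedOp_exprSS; apply: (subspace_scale jA.1).
exact: jordan_subalgebra_mulC.
Qed.

Lemma jordan_subalgebra_mul_affineX a (d e : R) k n : A a ->
  A (a ^+ k.+1 * (d *: a + e *: idOp V) ^+ n).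
Proof.
move=> Aa; elim: n k => [|n ih] k.
  by rewrite mulr1; exact: jordan_subalgebra_X.
rewrite boundedOp_mul_affineXS; apply: jA.1.2 => //.
exact: (subspace_scale jA.1).
Qed.

Lemma le_norm_unitization a (c : R) : closed A -> ~ A (idOp V) -> A a ->
  `|c| <= `|a + c *: idOp V|.
Proof.
move=> clA AI Aa; rewrite leNgt; apply/negP => Tc.
have c0 : c != 0 by rewrite -normr_gt0 (le_lt_trans _ Tc).
(* This is [(a + c I) / c]; the coefficient [1] stays explicit to match
   [jordan_subalgebra_mul_affineX]. *)
pose r : 'B(V) := c^-1 *: a + 1 *: idOp V.
have r1 : `|r| < 1.
  have -> : r = c^-1 *: (a + c *: idOp V).
    by rewrite scalerDr scalerA mulVf.
  by rewrite normrZ normfV mulrC ltr_pdivrMr ?normr_gt0// mul1r.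
apply: AI; apply: (@closed_cvg _ _ \oo _ (fun n => 1 - r ^+ n : 'B(V)) A) => //.
  near=> n.
  rewrite -opprB; apply: (subspace_opp jA.1).
  (* Since [r - 1 = c^-1 *: a], factoring [r ^+ n - 1] gives a sum of multiples of [a * r ^+ i]. *)
  rewrite subrX1 {1}/r scale1r addrK mulr_sumr.
  apply: (subspace_sum jA.1 _ (fun i => (c^-1 *: a) * r ^+ i)) => i.
  rewrite boundedOp_scalel -[a]expr1; apply: (subspace_scale jA.1).
  exact: jordan_subalgebra_mul_affineX.
rewrite -[idOp V]subr0; apply: cvgB; first exact: cvg_cst.
apply/norm_cvg0P.
apply: (@squeeze_cvgr _ _ _ _ (fun=> 0) (fun n => `|r| ^+ n)).
- by near=> n; rewrite normr_ge0 boundedOp_normX.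
- exact: cvg_cst.
- by apply: cvg_expr; rewrite normr_id.
Unshelve. all: by end_near. Qed.

Lemma unitization_jordan_subalgebra : jordan_subalgebra (unitization A).
Proof.
split; first exact: unitization_subspace.
rewrite (unitizationE jA.1) => _ [a [c [Aa ->]]].
exists (a * a + (c *: a + c *: a)), (c * c); split.
  by apply: (subspace_add jA.1);
    [exact: jA.2 | apply: (subspace_add jA.1); exact: (subspace_scale jA.1)].
by rewrite expr2 boundedOp_mul_affine.
Qed.

End algebra.

(** * Jordan homomorphisms and their unital extensions *)

Section homomorphisms.
Context {V W : normedModType R} {A : set 'B(V)} { pi : 'B(V) -> 'B(W)}.
Hypotheses (jA : jordan_subalgebra A) (jpi : jordan_homomorphism_on A pi).

Lemma jordan_homomorphism_X a n : A a -> pi (a ^+ n.+1) = pi a ^+ n.+1.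
Proof.
move=> Aa; elim: n => // n ih; have AX := jordan_subalgebra_X jA a n Aa.
rewrite boundedOp_exprSS (linear_on_scale jA.1 jpi.1); last first.
  exact: jordan_subalgebra_mulC.
by rewrite jpi.2// ih -boundedOp_exprSS.
Qed.

(** Although [pi] need not be multiplicative, it respects polynomials in a single element without
    constant term; the affine factor may contain the identity because a positive power of [a]
    precedes it. *)
Lemma jordan_homomorphism_mul_affineX a (d e : R) k n : A a ->
  pi (a ^+ k.+1 * (d *: a + e *: idOp V) ^+ n) =
  pi a ^+ k.+1 * (d *: pi a + e *: idOp W) ^+ n.
Proof.
move=> Aa; have AX k' m := jordan_subalgebra_mul_affineX jA a d e k' m Aa.
elim: n k => [|n ih] k; first by rewrite !mulr1; exact: jordan_homomorphism_X.
rewrite !boundedOp_mul_affineXS jpi.1 ?(linear_on_scale jA.1 jpi.1) ?ih//.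
exact: (subspace_scale jA.1).
Qed.

Lemma unital_extension_jordan : ~ A (idOp V) ->
  jordan_homomorphism_on (unitization A) (unital_extension A pi).
Proof.
move=> AI; split; first exact: (unital_extension_linear jA.1 jpi.1 AI).
have [sA _] := jA.
rewrite (unitizationE sA) => _ _ [a [c [Aa ->]]] [b [d [Ab ->]]].
(* The space is arbitrary because the expansion is used in [V] for the arguments and in [W] for
   their images. *)
have step (U : normedModType R) (x y : 'B(U)) :
    (x + c *: idOp U) * (y + d *: idOp U) +
    (y + d *: idOp U) * (x + c *: idOp U) =
    x * y + y * x + (2 * d *: x + 2 * c *: y) + (2 * (c * d)) *: idOp U.
  have dbl (k : R) (v : 'B(U)) : k *: v + k *: v = (2 * k) *: v.
    by rewrite -scalerDl mulr_natl.
  rewrite !boundedOp_mul_affine addrACA [d * c]mulrC dbl; congr (_ + _).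
  by rewrite addrACA; congr (_ + _); rewrite [c *: y + _]addrC addrACA !dbl.
have Aab := jordan_subalgebra_mulC jA a b Aa Ab.
have Acb : A (2 * c *: b) by exact: subspace_scale.
have Adab : A (2 * d *: a + 2 * c *: b) by exact: sA.2.
rewrite !step !(unital_extensionE sA AI)//; last exact: subspace_add.
rewrite (linear_on_add jpi.1)// jpi.2// jpi.1//.
by rewrite (linear_on_scale sA jpi.1)// step.
Qed.

End homomorphisms.

(** * Contractivity of the unital extension *)

Section contractive.
Context {H K : hilbertType R} {A : set 'B(H)} { pi : 'B(H) -> 'B(K)}.
Hypotheses (jA : jordan_subalgebra A) (jpi : jordan_homomorphism_on A pi).
Hypothesis cpi : contractive_on A pi.

(** The inverse of [1 - c T] is never formed: [S n] is [a] times a truncation of its geometric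
    series, lies in [A] for algebraic reasons, and contractivity of [pi] is applied to it. *)
Lemma jordan_homomorphism_contraction a (c : R) : A a -> `|c| < 1 ->
  `|a + c *: idOp H| <= 1 -> `|pi a + c *: idOp K| <= 1.
Proof.
move=> Aa c1 T1; set T := a + _ in T1 *; set U := pi a + _.
have Tx1 x : `|T x| <= `|x|.
  by rewrite (le_trans (boundedOp_le_norm T x))// ler_piMl.
(* What remains to show is that [U x - c *: x] is no longer than [x - c *: U x]. *)
apply: opnorm_le => // x; rewrite mul1r -(norm_moebius _ _ c)//.
pose C := c *: T; pose D := c *: U.
have CE : C = c *: a + c ^+ 2 *: idOp H by rewrite /C scalerDr scalerA.
have DE : D = c *: pi a + c ^+ 2 *: idOp K by rewrite /D scalerDr scalerA.
have AC n : A (a * C ^+ n).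
  by rewrite CE -[a in a * _]expr1; exact: jordan_subalgebra_mul_affineX.
have piC n : pi (a * C ^+ n) = pi a * D ^+ n.
  rewrite CE DE -[a in a * _]expr1 -[X in X * _]expr1.
  exact: (jordan_homomorphism_mul_affineX jA jpi).
have Cn n y : `|(C ^+ n) y| <= `|c| ^+ n * `|y|.
  elim: n => [|n ih]; first by rewrite expr0 mul1r.
  rewrite exprS boundedOpM boundedOpZ normrZ exprS -mulrA ler_wpM2l//.
  exact: le_trans (Tx1 _) ih.
(* Unlike in [subrX1], the factor [1 - E] stands on the right, since [1 - D] must act on [x]
   first. *)
have commsub (X : normedModType R) (E : 'B(X)) n :
    (\sum_(i < n) E ^+ i) * (1 - E) = 1 - E ^+ n.
  rewrite -opprB mulrN -[RHS]opprB; congr (- _); rewrite subrX1.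
  apply/esym/commr_sum => i _; apply/commrX/commr_sym.
  exact: commrB (commr_refl _) (commr1 _).
pose S n := \sum_(i < n) a * C ^+ i.
have AS n : A (S n) by exact: (subspace_sum jA.1 _ (fun i => a * C ^+ i)).
(* the truncation at order n of the transform of [T] is almost contractive *)
have S1 n : `|S n| <= 1 + `|c| ^+ n.
  apply: opnorm_le => [|y]; first by rewrite addr_ge0 ?exprn_ge0.
  (* As [a = T - c], the vector [S n y] is [T (G y) - c *: G y], and [norm_moebius] at [G y] bounds
     it by [G y - c *: T (G y)], which telescopes to [y - (C ^+ n) y]. *)
  pose G : 'B(H) := \sum_(i < n) C ^+ i.
  have -> : S n y = T (G y) - c *: G y.
    by rewrite /S -mulr_sumr boundedOpM /T boundedOpD boundedOpZ addrK.
  have GC : G y - c *: T (G y) = y - (C ^+ n) y.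
    rewrite -[LHS]/(((1 - C) * G) y) -[RHS]/((1 - C ^+ n) y).
    by rewrite -[1 - C]opprB mulNr -subrX1 opprB.
  rewrite (@le_trans _ _ `|G y - c *: T (G y)|)//.
    by rewrite norm_moebius.
  by rewrite GC (le_trans (ler_normB _ _))// mulrDl mul1r lerD.
have bE : pi a x = U x - c *: x by rewrite /U boundedOpD boundedOpZ addrK.
have cc1 : `| `|c| | < 1 by rewrite normr_id.
(* The first error term comes from the excess of the norm of [S n] over 1, the second from the
   remainder [(pi a * D ^+ n) x]. *)
apply: (@le_of_geometric_error _ `|c| _ _
  (`|x - c *: U x| + `|a| * `|x|)) => // n.
have SE : pi (S n) (x - c *: U x) = U x - c *: x - (pi a * D ^+ n) x.
  rewrite (linear_on_sum jA.1 jpi.1 _ (fun i => a * C ^+ i))//.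
  under eq_bigr do rewrite piC.
  rewrite -mulr_sumr -[x - _]/((1 - D) x) -boundedOpM.
  by rewrite -mulrA commsub mulrBr mulr1 -bE.
rewrite -[U x - _](subrK ((pi a * D ^+ n) x)) -SE.
rewrite (le_trans (ler_normD _ _))// mulrDr addrA lerD//.
  rewrite (le_trans (boundedOp_le_norm _ _))// -{2}[`|x - _|]mul1r -mulrDl.
  by rewrite ler_wpM2r// (le_trans (cpi _ (AS n))).
(* [D ^+ n] is not known to tend to 0, but [pi a * D ^+ n] does, since
   [pi a * D ^+ n = pi (a * C ^+ n)]. *)
rewrite -piC (le_trans (boundedOp_le_norm _ _))// mulrA ler_wpM2r//.
rewrite (le_trans (cpi _ (AC n)))// (le_trans (boundedOp_normM _ _))// mulrC.
by rewrite ler_wpM2r//; apply: opnorm_le; [rewrite exprn_ge0 | exact: Cn].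
Qed.

Lemma unital_extension_contractive : closed A -> ~ A (idOp H) ->
  contractive_on (unitization A) (unital_extension A pi).
Proof.
move=> clA AI; rewrite (unitizationE jA.1) => _ [a [c [Aa ->]]].
rewrite (unital_extensionE jA.1 AI)//; apply/ler_addgt0Pr => e e0.
have cT := le_norm_unitization jA a c clA AI Aa.
set t := `|a + _| in cT *.
(* Dividing by [t + e] instead of [t] makes the rescaled scalar strictly less than 1 in absolute
   value, and covers [t = 0]. *)
have s0 : 0 < t + e by apply: ltr_wpDl => //; exact: normr_ge0.
have normZ (x : R) : `|(t + e)^-1 * x| = (t + e)^-1 * `|x|.
  by rewrite normrM ger0_norm// invr_ge0 ltW.
have lts x : x <= t -> (t + e)^-1 * x < 1.
  by move=> xt; rewrite mulrC ltr_pdivrMr// mul1r (le_lt_trans xt)// ltrDl.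
have := @jordan_homomorphism_contraction ((t + e)^-1 *: a) ((t + e)^-1 * c).
rewrite (linear_on_scale jA.1 jpi.1)// -!scalerA -!scalerDr normZ !normrZ.
rewrite ger0_norm ?invr_ge0 ?(ltW s0)// -/t.
move=> /(_ (subspace_scale jA.1 _ _ Aa) (lts _ cT) (ltW (lts _ (lexx t)))).
by rewrite mulrC ler_pdivrMr// mul1r.
Qed.

End contractive.
End jordan.

(** * The associative case, and the theorem *)

Lemma subalgebra_jordan (R : realType) (V : normedModType R) (A : set 'B(V)) :
  subalgebra A -> jordan_subalgebra A.
Proof. by move=> [sA mA]; split=> // a Aa; exact: mA. Qed.

Lemma homomorphism_jordan (R : realType) (V W : normedModType R)
    (A : set 'B(V)) (pi : 'B(V) -> 'B(W)) :
  subalgebra A -> homomorphism_on A pi -> jordan_homomorphism_on A pi.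
Proof.
move=> [sA mA] [lpi mpi]; split=> // a b Aa Ab.
by rewrite (linear_on_add lpi) ?mpi//; exact: mA.
Qed.

Lemma unitization_subalgebra (R : realType) (V : normedModType R)
    (A : set 'B(V)) : subalgebra A -> subalgebra (unitization A).
Proof.
move=> [sA mA]; split; first exact: unitization_subspace.
rewrite (unitizationE sA) => _ _ [a [c [Aa ->]]] [b [d [Ab ->]]].
exists (a * b + (d *: a + c *: b)), (c * d).
split; last by rewrite boundedOp_mul_affine.
apply: (subspace_add sA); first exact: mA.
by apply: sA.2 => //; exact: subspace_scale.
Qed.

Lemma unital_extension_homomorphism (R : realType) (V W : normedModType R)
    (A : set 'B(V)) (pi : 'B(V) -> 'B(W)) :
  subalgebra A -> ~ A (idOp V) -> homomorphism_on A pi ->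
  homomorphism_on (unitization A) (unital_extension A pi).
Proof.
move=> [sA mA] AI [lpi mpi].
split; first exact: (unital_extension_linear sA lpi AI).
rewrite (unitizationE sA) => _ _ [a [c [Aa ->]]] [b [d [Ab ->]]].
have Acb : A (c *: b) by exact: subspace_scale.
have Adab : A (d *: a + c *: b) by exact: sA.2.
have Aab := mA a b Aa Ab.
rewrite boundedOp_mul_affine !(unital_extensionE sA AI)//; last first.
  exact: subspace_add.
rewrite boundedOp_mul_affine (linear_on_add lpi)// mpi// lpi//.
by rewrite (linear_on_scale sA lpi).
Qed.

Theorem theorem3p2 (R : realType) (H K : hilbertType R)
    (A : set 'B(H)) (pi : 'B(H) -> 'B(K)) :
  closed A -> ~ A (idOp H) ->
  (subalgebra A -> homomorphism_on A pi -> contractive_on A pi ->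
    [/\ forall a (c : R), A a ->
          unital_extension A pi (a + c *: idOp H) = pi a + c *: idOp K,
        subalgebra (unitization A),
        homomorphism_on (unitization A) (unital_extension A pi) &
        contractive_on (unitization A) (unital_extension A pi)]) /\
  (jordan_subalgebra A -> jordan_homomorphism_on A pi -> contractive_on A pi ->
    [/\ forall a (c : R), A a ->
          unital_extension A pi (a + c *: idOp H) = pi a + c *: idOp K,
        jordan_subalgebra (unitization A),
        jordan_homomorphism_on (unitization A) (unital_extension A pi) &
        contractive_on (unitization A) (unital_extension A pi)]).
Proof.
move=> clA AI; split=> hA hpi cpi.
  have jA := subalgebra_jordan _ _ _ hA.
  have jpi := homomorphism_jordan _ _ _ _ _ hA hpi.
  split.
  - by move=> a c; exact: (unital_extensionE hA.1 AI).
  - exact: unitization_subalgebra.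
  - exact: unital_extension_homomorphism.
  - exact: (unital_extension_contractive jA jpi).
split.
- by move=> a c; exact: (unital_extensionE hA.1 AI).
- exact: unitization_jordan_subalgebra.
- exact: unital_extension_jordan.
- exact: unital_extension_contractive.
Qed.
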